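(* Let $(X,f)$ be a dynamical system, let $A\subset X$ be a closed $f$-invariant set containing the measure center of $(X,f)$, and let $\alpha\in[0,1)$. If $f|_A$ has the $\mathscr{M}_{\alpha}$-shadowing property on $A$, then $f$ has the $\mathscr{M}_{\alpha}$-shadowing property on $X$.
   Context: $\mathbb{N}_0=\{0,1,2,\dots\}$. A dynamical system $(X,f)$ is a compact metric space $(X,d)$ together with a continuous map $f\colon X\to X$. A set $A$ is invariant if $f(A)\subset A$. A Borel probability measure $\mu$ on $X$ is invariant if $\mu(B)=\mu(f^{-1}(B))$ for all Borel $B\subset X$. A subset $S\subset X$ is measure saturated if for every open $U$ with $U\cap S\ne\emptyset$ there is an invariant measure $\mu$ with $\mu(U)>0$; the measure center of $f$ is the largest measure saturated subset of $X$. For $E\subset\mathbb{N}_0$, $\underline{d}(E)=\liminf_{n\to\infty}\frac1n|E\cap\{0,\dots,n-1\}|$. A sequence $\{x_i\}_{i=0}^\infty\subset X$ is a $\delta$-ergodic pseudo-orbit of $f$ if $\lim_{n\to\infty}\frac1n|\{0\le i<n: d(f(x_i),x_{i+1})\ge\delta\}|=0$. A system $(X,f)$ has the $\mathscr{M}_{\alpha}$-shadowing property if for every $\varepsilon>0$ there is $\delta>0$ such that for every $\delta$-ergodic pseudo-orbit $\{x_i\}_{i=0}^\infty$ there is $z\in X$ with $\underline{d}(\{i\in\mathbb{N}_0: d(f^i(z),x_i)<\varepsilon\})>\alpha$; for $f|_A$ this is applied to the system $(A,f|_A)$. *)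

(* Defs.v *)
From HB Require Import structures.
From mathcomp Require Import all_boot all_order all_algebra.
From mathcomp Require Import all_classical all_reals all_analysis.

Set Implicit Arguments.
Unset Strict Implicit.
Unset Printing Implicit Defensive.

Import Order.TTheory GRing.Theory Num.Theory.
Import numFieldNormedType.Exports.

Local Open Scope classical_set_scope.
Local Open Scope ring_scope.

(* Measurable types are pointed in the library; naming the base point explicitly
   avoids adding to the metric space a structure that excludes the empty one.
   The choice of [x0] affects neither the sigma-algebra nor the measures. *)
Definition pointed_at (X : Type) (x0 : X) : Type := X.

HB.instance Definition _ (X : choiceType) (x0 : X) :=
  Choice.on (pointed_at x0).
HB.instance Definition _ (X : choiceType) (x0 : X) :=
  isPointed.Build (pointed_at x0) x0.

Definition borel (X : topologicalType) (x0 : X) :=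
  g_sigma_algebraType (@open X : set (set (pointed_at x0))).

Section MeasureCenter.
Variables (R : realType) (X : metricType R) (f : X -> X).

Definition invariant_measure (x0 : X) (mu : probability (borel x0) R) : Prop :=
  forall B : set (borel x0), measurable B -> mu B = mu (f @^-1` B).

Definition measure_saturated (S : set X) : Prop :=
  forall U : set X, open U -> U `&` S !=set0 ->
    exists (x0 : X) (mu : probability (borel x0) R),
      invariant_measure mu /\ (0 < mu U)%E.

Definition measure_center : set X :=
  \bigcup_(S in measure_saturated) S.

Lemma measure_center_saturated : measure_saturated measure_center.
Proof.
move=> U oU [x [Ux [S satS Sx]]].
by apply: satS => //; exists x.
Qed.

Lemma measure_center_max (S : set X) :
  measure_saturated S -> S `<=` measure_center.
Proof. by move=> satS x Sx; exists S. Qed.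

End MeasureCenter.

Section Density.
Variable R : realType.

Definition frequency (E : set nat) (n : nat) : R :=
  #|[pred i : 'I_n | (i : nat) \in E]|%:R / n%:R.

Definition lower_density (E : set nat) : \bar R :=
  limn_einf (fun n => (frequency E n)%:E).

End Density.

Section Shadowing.
Variables (R : realType) (X : metricType R) (f : X -> X).

Definition ergodic_pseudo_orbit (delta : R) (x : nat -> X) : Prop :=
  frequency R [set i | delta <= mdist (f (x i)) (x i.+1)] n @[n --> \oo] --> 0.

Definition M_shadowing (alpha : R) : Prop :=
  forall eps : R, 0 < eps -> exists2 delta : R, 0 < delta &
    forall x : nat -> X, ergodic_pseudo_orbit delta x ->
      exists z : X,
        (alpha%:E < lower_density R [set i | (mdist (iter i f z) (x i) < eps)%R])%E.

End Shadowing.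

(* The pseudometric on [set_type A] is already the one induced by [X]. *)
Section Subspace.
Variables (R : realType) (X : metricType R) (A : set X).

Let dist (x y : A) : R := mdist (set_val x) (set_val y).

Let dist_ge0 x y : 0 <= dist x y.
Proof. exact: mdist_ge0. Qed.

Let dist_positivity x y : dist x y = 0 -> x = y.
Proof. by move/mdist_positivity/val_inj. Qed.

Let ballE (x : A) (r : R) : ball x r = [set y | dist x y < r].
Proof. by rewrite /ball/= /initial_ball ballEmdist. Qed.

HB.instance Definition _ := PseudoMetric_isMetric.Build R (set_type A)
  dist_ge0 dist_positivity ballE.

Definition restrict_sys (f : X -> X) (fA : set_fun A A f) (x : A) : A :=
  SigSub (mem_set (fA (set_val x) (set_valP x))).

End Subspace.

(* Main.v *)
Require Import Defs.
From HB Require Import structures.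
From mathcomp Require Import all_boot all_order all_algebra.
From mathcomp Require Import all_classical all_reals all_analysis.
From mathcomp Require Import lra ring zify.

(** Why the theorem is true.

    Suppose that [f] fails the shadowing property on [X] for some [eps].  Then
    for every [k] there is a [1/(k+1)]-ergodic pseudo-orbit [x k] that no point
    of [X] shadows within [eps] on a set of lower density above [alpha].
    Failing to be shadowed is visible in finite time, uniformly in the
    shadowing point: by compactness of [X], whatever number [s] of free hits
    is conceded, some initial segment of [x k] is so long that every orbit has,
    at some time [n] within it, fewer than [(alpha + 1/(k+1)) n - s]
    [eps/2]-close encounters with [x k] ([unshadowable_segment]).

    Glue such initial segments of [x 0], [x 1], ... one after the other, the
    [k]-th one chosen long compared with the past, and long enough to make the
    few early errors of the next one negligible.  The result [y] is a
    [delta]-ergodic pseudo-orbit for all [delta] at once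
    ([concatenated_pseudo_orbit]), and no orbit follows it within [eps/2] with
    lower density above [alpha], because every segment defeats every orbit.

    On the other hand such a [y] can be shadowed
    ([shadow_asymptotic_pseudo_orbit]).  Its errors are negligible at every
    scale, so the limits of the empirical measures along [y] are exactly
    invariant; they are carried by the measure center, hence [y] leaves any
    neighbourhood of [A] only on a set of times of density zero
    ([asymptotic_pseudo_orbit_null]).  Replacing each [y i] by a nearby point
    of [A] therefore gives an ergodic pseudo-orbit of the restriction, and a
    point of [A] shadowing it shadows [y] with the same density.

    The invariant measure is obtained without duality.  Limits of frequencies
    along an ultrafilter give a shift-invariant finitely additive density on
    sets of times ([exists_generalized_density]); transported by [y] it is a
    finitely additive content on all subsets of [X].  Inner regularization on
    open sets, outer regularization and the theorem of Caratheodory turn the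
    content into a Borel probability
    ([borel_probability_of_content]). *)

Set Implicit Arguments.
Unset Strict Implicit.
Unset Printing Implicit Defensive.

Import Order.TTheory GRing.Theory Num.Theory.
Import numFieldNormedType.Exports.

Local Open Scope classical_set_scope.
Local Open Scope ring_scope.

(** * Counting and densities of sets of integers *)
Definition hits (E : set nat) (n : nat) : nat := \sum_(i < n) ((i : nat) \in E).

Section Counting.
Implicit Types (E : set nat) (m n : nat).

Lemma hits0 E : hits E 0 = 0%N.
Proof. by rewrite /hits big_ord0. Qed.

Lemma hitsS E n : hits E n.+1 = (hits E n + (n \in E))%N.
Proof. by rewrite /hits big_ord_recr. Qed.

Lemma hits_le E n : (hits E n <= n)%N.
Proof. by elim: n => [|n IH]; rewrite ?hits0// hitsS; case: (n \in E); lia. Qed.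

Lemma hitsT n : hits setT n = n.
Proof. by elim: n => [|n IH]; rewrite ?hits0// hitsS IH in_setT addn1. Qed.

Lemma hits_cat E m n :
  hits E (m + n) = (hits E m + hits [set i | E (m + i)%N] n)%N.
Proof.
elim: n => [|n IH]; first by rewrite addn0 hits0 addn0.
by rewrite addnS !hitsS IH addnA.
Qed.

Lemma hits_mono E m n : (m <= n)%N -> (hits E m <= hits E n)%N.
Proof. by move=> /subnKC <-; rewrite hits_cat leq_addr. Qed.

Lemma hits_sub E E' n :
  (forall i, (i < n)%N -> E i -> E' i) -> (hits E n <= hits E' n)%N.
Proof.
move=> EE'; rewrite /hits; apply: leq_sum => i _.
case: (boolP (nat_of_ord i \in E)) => //= /set_mem/(EE' i (ltn_ord i)) Ei.
by rewrite mem_set.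
Qed.

Lemma hits_setU E E' n : (hits (E `|` E') n <= hits E n + hits E' n)%N.
Proof.
rewrite /hits -big_split/=; apply: leq_sum => i _.
rewrite in_setU; by case: (_ \in E); case: (_ \in E').
Qed.

Lemma hits_setU_disj E E' n : E `&` E' = set0 ->
  hits (E `|` E') n = (hits E n + hits E' n)%N.
Proof.
move=> EE'; rewrite /hits -big_split/=; apply: eq_bigr => i _.
have := in_setI (nat_of_ord i) E E'; rewrite EE' in_set0 in_setU.
by case: (_ \in E); case: (_ \in E').
Qed.

Lemma hits_shift E n : (hits [set i | E i.+1] n <= hits E n + 1)%N /\
  (hits E n <= hits [set i | E i.+1] n + 1)%N.
Proof.
have := hits_cat E 1 n; rewrite (_ : [set i | E (1 + i)%N] = [set i | E i.+1])//.
rewrite add1n !hitsS hits0 add0n.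
by case: (0%N \in E); case: (n \in E); lia.
Qed.

End Counting.

Section Density.
Variable R : realType.
Implicit Types (E : set nat).

Lemma frequencyE E n : frequency R E n = (hits E n)%:R / n%:R.
Proof.
by rewrite /frequency /hits -sum1_card big_mkcond.
Qed.

Lemma frequency_ge0 E n : 0 <= frequency R E n.
Proof. by rewrite frequencyE divr_ge0. Qed.

Lemma frequency_le1 E n : frequency R E n <= 1.
Proof.
rewrite frequencyE; case: n => [|n]; first by rewrite invr0 mulr0.
by rewrite ler_pdivrMr ?ltr0n// mul1r ler_nat hits_le.
Qed.

Definition null_density E := frequency R E n @[n --> \oo] --> 0.

(** An affine bound with a free additive constant replaces the limit: it is
    stable under restriction, shift and gluing without any division, and it
    holds from [n = 0] on. *)
Lemma null_densityP E : null_density E <->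
  forall eta : R, 0 < eta -> exists B : nat,
    forall n, (hits E n)%:R <= eta * n%:R + B%:R.
Proof.
split=> [nE eta eta0|h].
  move/cvgrPdist_le : nE => /(_ _ eta0)[B _ hB]; exists B => n.
  have [Bn|nB] := leqP B n; last first.
    have cB : (hits E n)%:R <= B%:R :> R.
      by rewrite ler_nat (leq_trans (hits_le _ _))// ltnW.
    by rewrite (le_trans cB)// lerDr mulr_ge0// ltW.
  have := hB n Bn; rewrite sub0r normrN ger0_norm ?frequency_ge0// frequencyE.
  case: n Bn {hB} => [|n] Bn; first by rewrite hits0 mulr0 add0r.
  rewrite ler_pdivrMr ?ltr0n// => /le_trans; apply.
  by rewrite lerDl.
apply/cvgrPdist_le => e e0.
have e20 : 0 < e / 2 by rewrite divr_gt0.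
have [B hB] := h _ e20.
exists (Num.truncn (B%:R / (e / 2))).+1 => // n /= Bn.
rewrite sub0r normrN ger0_norm ?frequency_ge0// frequencyE.
have n0 : 0 < n%:R :> R by rewrite ltr0n; case: n Bn.
rewrite ler_pdivrMr// (le_trans (hB n))//.
have : B%:R / (e / 2) < n%:R.
  by rewrite (lt_le_trans (truncnS_gt _))// ler_nat.
rewrite ltr_pdivrMr// => Bn'; rewrite [leRHS](_ : _ = e / 2 * n%:R + n%:R * (e / 2)).
  by rewrite lerD2l ltW.
by rewrite {1}(splitr e); ring.
Qed.

Lemma null_density_sub E E' : E `<=` E' -> null_density E' -> null_density E.
Proof.
move=> EE' /null_densityP nE'; apply/null_densityP => e e0; have [B hB] := nE' e e0.
exists B => n; rewrite (le_trans _ (hB n))// ler_nat.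
by apply: hits_sub => i _; exact: EE'.
Qed.

Lemma null_density_setU E E' :
  null_density E -> null_density E' -> null_density (E `|` E').
Proof.
move=> nE nE'; apply: (@squeeze_cvgr _ _ _ _ (fun=> 0)
  (fun n => frequency R E n + frequency R E' n)); last 2 first.
- exact: cvg_cst.
- by rewrite -[X in _ --> X]addr0; exact: cvgD.
apply: nearW => n; rewrite frequency_ge0/= !frequencyE -mulrDl.
by rewrite ler_wpM2r ?invr_ge0// -natrD ler_nat hits_setU.
Qed.

Lemma null_density_shift E : null_density E -> null_density [set i | E i.+1].
Proof.
move=> /null_densityP nE; apply/null_densityP => e e0; have [B hB] := nE e e0.
exists B.+1 => n; have [h _] := hits_shift E n.
rewrite -natr1 addrA (le_trans _ (lerD (hB n) (lexx 1)))//.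
by rewrite natr1 ler_nat -addn1.
Qed.

(** The counterpart of [null_densityP] for lower densities; the strict
    inequality is what leaves room for the additive constant. *)
Lemma lower_densityP E (a : R) : (a%:E < lower_density R E)%E <->
  exists2 c : R, a < c & exists B : nat,
    forall n, c * n%:R <= (hits E n)%:R + B%:R.
Proof.
rewrite /lower_density limn_einf_lim; set u := fun n => _.
have := @cvg_einfs_sup R u => /cvg_lim -> //.
split=> [/ereal_sup_gt[_ [N _ <-] aN]|[c ac [B hB]]].
- have [c ac cN] : exists2 c : R, a < c & (c%:E <= einfs u N)%E.
    case E1 : (einfs u N) aN => [r| |] // ar; first by exists r.
    by exists (a + 1); rewrite ?ltrDl// leey.
  have {cN} cu n : (N <= n)%N -> c <= frequency R E n.
    move=> Nn; rewrite -lee_fin (le_trans cN)//.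
    by apply: ereal_inf_lbound; exists n.
  exists c => //; exists (Num.truncn `|c| * N + N)%N => n.
  have [Nn|nN] := leqP N n.
    case: n Nn => [|n] Nn; first by rewrite mulr0 hits0 add0r.
    have := cu _ Nn; rewrite frequencyE ler_pdivlMr ?ltr0n// => /le_trans; apply.
    by rewrite lerDl.
  rewrite (@le_trans _ _ (((Num.truncn `|c|).+1%:R) * N%:R))//.
    rewrite (@le_trans _ _ (`|c| * n%:R))//.
      by rewrite ler_wpM2r// ler_norm.
    by rewrite ler_pM// ?ler_nat ?(ltnW nN)// ltW// truncnS_gt.
  by rewrite -natrM mulSn addnC lerDr.
- pose d := (c - a) / 2; have d0 : 0 < d by rewrite divr_gt0// subr_gt0.
  pose N := (Num.truncn (B%:R / d)).+1.
  apply: (@lt_le_trans _ _ (c - d)%:E).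
    by rewrite lte_fin /d; lra.
  apply: (@le_trans _ _ (einfs u N)); last by apply: ereal_sup_ubound; exists N.
  apply: le_ereal_inf_tmp => _ [n /= Nn <-]; rewrite /u lee_fin frequencyE.
  have n0 : 0 < n%:R :> R by rewrite ltr0n; case: n Nn.
  rewrite ler_pdivlMr// mulrBl lerBlDr (le_trans (hB n))// lerD2l.
  have : B%:R / d < n%:R by rewrite (lt_le_trans (truncnS_gt _))// ler_nat.
  by rewrite ltr_pdivrMr// mulrC => /ltW.
Qed.

End Density.

(** * Finitely additive densities along an ultrafilter *)
Section GeneralizedDensity.
Variable R : realType.

Lemma ultra_cvg_frequency (F : set_system nat) (E : set nat) :
  UltraFilter F -> cvg (frequency R E n @[n --> F]).
Proof.
move=> UF; have PF : ProperFilter F := @ultra_proper _ _ UF.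
have FF : ProperFilter (frequency R E @ F) by apply: fmap_proper_filter.
have [|l [_ cl]] := @segment_compact R 0 1 (frequency R E @ F) FF.
  by apply: nearW => n /=; rewrite in_itv/= frequency_ge0 frequency_le1.
apply/cvg_ex; exists l => U nU.
have [//|FU] := in_ultra_setVsetC (frequency R E @^-1` U) UF.
by have [r [/= ]] := cl (~` U) U FU nU.
Qed.

(** The ultrafilter refines the tail filter restricted to the times at which
    [P] is frequent, so that [P] keeps a positive density.  Refining the tail
    filter is also why the density is shift-invariant and ignores sets of
    density zero. *)
Lemma exists_generalized_density (P : set nat) : ~ null_density R P ->
  exists m : set nat -> R,
  [/\ [/\ 0 < m P, m setT = 1 & forall E, 0 <= m E],
      forall E E', E `&` E' = set0 -> m (E `|` E') = m E + m E',
      forall E, m [set i | E i.+1] = m E &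
      forall E E' N, null_density R N -> E `<=` E' `|` N -> m E <= m E'].
Proof.
move=> nP.
have [eta eta0 hP] : exists2 eta : R, 0 < eta &
    forall B : nat, exists n : nat, eta * n%:R + B%:R < (hits P n)%:R.
  apply: contrapT => /forall2NP h; apply: nP; apply/null_densityP => e e0.
  have [//|/existsNP[B hB]] := h e; exists B => n.
  by rewrite leNgt; apply/negP => Bn; apply: hB; exists n.
pose G : set nat := [set n | eta <= frequency R P n].
have PG : ProperFilter (within G \oo).
  apply: Build_ProperFilter_ex => Q [N _ NQ]; have [n hn] := hP N.
  have Nn : (N <= n)%N.
    rewrite -(ler_nat R) (le_trans _ (le_trans (ltW hn) _))//.
      by rewrite lerDr mulr_ge0// ltW.
    by rewrite ler_nat hits_le.
  exists n; apply: NQ => //=; rewrite /G/= frequencyE.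
  case: n hn {Nn} => [|n] hn.
    by move: hn; rewrite hits0 mulr0 add0r ltrn0.
  by rewrite ler_pdivlMr ?ltr0n// (le_trans _ (ltW hn))// lerDl.
have [F [UF sF]] := ultraFilterLemma PG.
have PF : ProperFilter F := @ultra_proper _ _ UF.
have Foo : F --> \oo by move=> A ooA; apply: sF; apply: filterS ooA => n An _.
have cvF E : cvg (frequency R E n @[n --> F]) := ultra_cvg_frequency UF.
have limF E l : frequency R E n @[n --> \oo] --> l ->
    lim (frequency R E n @[n --> F]) = l.
  by move=> El; apply/cvg_lim => //; apply: cvg_trans El; exact: cvg_app.
have mono E E' N : null_density R N -> E `<=` E' `|` N ->
    lim (frequency R E n @[n --> F]) <= lim (frequency R E' n @[n --> F]).
  move=> nN EE'; rewrite -[leRHS]addr0 -(limF _ _ nN) -limD//.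
  apply: ler_lim => //; first exact: is_cvgD.
  apply: nearW => n; rewrite -[leRHS]/(frequency R E' n + frequency R N n).
  rewrite !frequencyE -mulrDl ler_wpM2r ?invr_ge0//.
  rewrite -natrD ler_nat (leq_trans _ (hits_setU _ _ _))//.
  by apply: hits_sub => i _; exact: EE'.
exists (fun E => lim (frequency R E n @[n --> F])); split => //.
- split => [||E].
  + rewrite (lt_le_trans eta0)//; apply: limr_ge => //.
    by apply: sF; exact: withinT.
  + apply: limF; apply: cvg_near_cst; exists 1%N => // n /= n0.
    by rewrite frequencyE hitsT divff// pnatr_eq0 -lt0n.
  + by apply: limr_ge => //; apply: nearW => n; exact: frequency_ge0.
- move=> E E' EE'; rewrite -limD//; congr (lim (_ @ F)).
  apply/funext => n; rewrite -[RHS]/(frequency R E n + frequency R E' n).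
  by rewrite !frequencyE hits_setU_disj// natrD mulrDl.
- have inv0 : (n%:R^-1 : R) @[n --> \oo] --> 0.
    by apply/gtr0_cvgV0; [exists 1%N => // n /= n0; rewrite ltr0n|exact: cvgr_idn].
  move=> E; apply/eqP; rewrite -subr_eq0 -limB//; apply/eqP; apply/cvg_lim => //.
  apply: cvg_trans (cvg_app _ Foo) _.
  apply: (@squeeze_cvgr _ _ _ _ (fun n => - (n%:R^-1)) (fun n => n%:R^-1)) => //.
    apply: nearW => n.
    rewrite -[X in _ <= X <= _]/(frequency R [set i | E i.+1] n - frequency R E n).
    rewrite !frequencyE -mulrBl; have [h1 h2] := hits_shift E n.
    apply/andP; split; last first.
      rewrite -[leRHS]mul1r ler_wpM2r ?invr_ge0//.
      by rewrite lerBlDr nat1r ler_nat -addn1.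
    rewrite -[leLHS]mulN1r ler_wpM2r ?invr_ge0//.
    by rewrite lerBrDr addrC lerBlDr natr1 ler_nat -addn1.
  by rewrite -oppr0; exact: cvgN.
Qed.

End GeneralizedDensity.

(** * From a content on a compact metric space to a Borel probability *)
Section MetricTopology.
Variables (R : realType) (X : metricType R).

Lemma metric_openP (U : set X) : open U <->
  forall x, U x -> exists2 r : R, 0 < r & forall y, mdist x y < r -> U y.
Proof.
rewrite openE; split=> oU x Ux.
  have /nbhs_ballP[r r0 rU] := oU x Ux; exists r => // y xy.
  by apply: rU; rewrite ballEmdist.
have [r r0 rU] := oU x Ux; apply/nbhs_ballP; exists r => //= y.
by rewrite ballEmdist => /rU.
Qed.

(** A closed set inside [U], which stands in for the points at distance at
    least [r] from the complement and makes sense when [U] is the whole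
    space. *)
Definition inner (U : set X) (r : R) : set X :=
  [set x | forall y, mdist x y < r -> U y].

Lemma inner_sub U r : 0 < r -> inner U r `<=` U.
Proof. by move=> r0 x; apply; rewrite mdistxx. Qed.

Lemma closed_inner U r : closed (inner U r).
Proof.
rewrite -openC; apply/metric_openP => x /existsNP[y /not_implyP[xy Uy]].
exists (r - mdist x y); first by rewrite subr_gt0.
move=> z xz zU; apply: Uy; apply: zU.
rewrite (le_lt_trans (metric_triangle _ x _))// metric_sym.
by rewrite -ltrBrDr.
Qed.

Lemma near_metric (x : X) (r : R) : 0 < r -> \forall y \near x, mdist x y < r.
Proof.
by move=> r0; apply/nbhs_ballP; exists r => //= y; rewrite ballEmdist.
Qed.

Lemma near_invS (r : R) : 0 < r -> \forall n \near \oo, n.+1%:R^-1 < r.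
Proof.
move=> r0; exists (Num.truncn r^-1) => // n /= rn.
by rewrite invf_plt ?posrE// -truncn_le_nat.
Qed.

(** Combines the extraction of a finite subcover with a shrinking of it to
    closed sets, a single integer controlling both. *)
Lemma compact_inner_cover (K : set X) (U : nat -> set X) :
  compact K -> (forall n, open (U n)) -> K `<=` \bigcup_n U n ->
  exists n, K `<=` \bigcup_(j < n) inner (U j) n.+1%:R^-1.
Proof.
move=> /compact_near_coveringP cK oU KU.
have [|N _ hN] := cK nat \oo
    (fun n x => (\bigcup_(j < n) inner (U j) n.+1%:R^-1) x) _; last first.
  by exists N; exact: (hN N (leqnn N)).
move=> x /KU[j _ Ujx]; have /metric_openP/(_ x Ujx)[r r0 rU] := oU j.
have r20 : 0 < r / 2 by rewrite divr_gt0.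
near=> y n => /=.
have xy : mdist x y < r / 2 by near: y; exact: near_metric.
have nr : n.+1%:R^-1 < r / 2 by near: n; exact: near_invS.
exists j; first by rewrite /=; near: n; exists j.+1.
move=> z yz; apply: rU; rewrite (le_lt_trans (metric_triangle _ y _))//.
by rewrite [ltRHS]splitr ltrD// (lt_trans yz).
Unshelve. all: by end_near. Qed.

Lemma compact_inner (K U : set X) : compact K -> open U -> K `<=` U ->
  exists2 r : R, 0 < r & K `<=` inner U r.
Proof.
move=> cK oU KU.
have [|n Kn] := @compact_inner_cover K (fun=> U) cK (fun=> oU).
  by move=> x /KU Ux; exists 0%N.
by exists n.+1%:R^-1; rewrite ?invr_gt0// => x /Kn[].
Qed.

End MetricTopology.

Section BorelProbability.
Variables (R : realType) (X : metricType R).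
Local Open Scope ereal_scope.

(** The Caratheodory sets form a sigma-algebra, so it contains the Borel sets
    as soon as it contains the open ones. *)
Lemma borel_probability_of_outer_measure
    (mu : {outer_measure set X -> \bar R}) (x0 : X) :
  (forall U : set X, open U -> mu.-caratheodory U) -> mu setT = 1 ->
  exists P : probability (borel x0) R, forall B : set X, P B = mu B.
Proof.
move=> mU muT.
pose nu : {outer_measure set (pointed_at x0) -> \bar R} := mu.
have borel_cara (B : set (borel x0)) : measurable B -> nu.-caratheodory B.
  apply: smallest_sub => //.
  have := @sigma_algebra_measurable _ (caratheodory_type nu).
  exact.
have sa : semi_sigma_additive (mu : set (borel x0) -> \bar R).
  move=> F mF tF _.
  apply: (@caratheodory_measure_sigma_additive R (pointed_at x0) nu) => //.
    by move=> i; exact: borel_cara.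
  apply: caratheodory_measurable_bigcup => i; exact: borel_cara.
pose mA := isMeasure.Build _ (borel x0) R (mu : set (borel x0) -> \bar R)
  (outer_measure0 mu) (outer_measure_ge0 mu) sa.
pose m : {measure set (borel x0) -> \bar R} :=
  HB.pack (mu : set (borel x0) -> \bar R) mA.
pose pA := Measure_isProbability.Build _ (borel x0) R (Measure.sort m) muT.
pose P : probability (borel x0) R := HB.pack (Measure.sort m) pA.
by exists P.
Qed.

End BorelProbability.

Section OuterMeasureOfContent.
Variables (R : realType) (X : metricType R).
Hypothesis cX : compact [set: X].
Variable c : set X -> R.
Hypothesis c_ge0 : forall K, 0 <= c K.
Hypothesis c_mono : forall K L, K `<=` L -> c K <= c L.
Hypothesis c_add : forall K L, K `&` L = set0 -> c (K `|` L) = c K + c L.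

Local Open Scope ereal_scope.

Definition open_content (U : set X) : \bar R :=
  ereal_sup [set (c K)%:E | K in [set K | closed K /\ K `<=` U]].

Definition content_outer (E : set X) : \bar R :=
  ereal_inf [set open_content U | U in [set U | open U /\ E `<=` U]].

Let compact_closed_set (K : set X) : closed K -> compact K.
Proof. by move=> clK; exact: (subclosed_compact clK cX). Qed.

Lemma content_set0 : c set0 = 0%R.
Proof.
have := c_add (setI0 set0); rewrite setU0 => /eqP.
by rewrite -{1}[c set0]addr0 (inj_eq (addrI _)) => /eqP.
Qed.


Lemma content_le_open K U : closed K -> K `<=` U -> (c K)%:E <= open_content U.
Proof. by move=> clK KU; apply: ereal_sup_ubound; exists K. Qed.

Lemma open_content_ge0 U : 0 <= open_content U.
Proof.
by rewrite (le_trans _ (@content_le_open set0 U closed0 _))// lee_fin.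
Qed.

Lemma open_content_mono U V : U `<=` V -> open_content U <= open_content V.
Proof.
move=> UV; apply: ge_ereal_sup => _ [K [clK KU] <-].
by apply: content_le_open => //; exact: subset_trans UV.
Qed.

Lemma open_content_fin U : open_content U \is a fin_num.
Proof.
rewrite ge0_fin_numE ?open_content_ge0//.
rewrite (@le_lt_trans _ _ (c setT)%:E) ?ltry//.
by apply: ge_ereal_sup => _ [K _ <-]; rewrite lee_fin c_mono.
Qed.

(** The only use of compactness in the construction: finite additivity of [c]
    is upgraded to countable subadditivity because a closed set covered by
    countably many open sets is covered by finitely many shrunken ones. *)
Lemma open_content_bigcup (U : nat -> set X) : (forall n, open (U n)) ->
  open_content (\bigcup_n U n) <= \sum_(n <oo) open_content (U n).
Proof.
move=> oU; apply: ge_ereal_sup => _ [K [clK KU] <-].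
have [n Kn] := compact_inner_cover (compact_closed_set clK) oU KU.
pose L j := inner (U j) n.+1%:R^-1.
have cL m : (c (\bigcup_(j < m) L j))%:E <= \sum_(0 <= j < m) (c (L j))%:E.
  elim: m => [|m IH]; first by rewrite big_geq// bigcup_mkord big_ord0 content_set0.
  rewrite big_nat_recr//= (le_trans _ (leeD2r _ IH))// -EFinD lee_fin.
  have -> : \bigcup_(j < m.+1) L j =
      (\bigcup_(j < m) L j) `|` (L m `\` \bigcup_(j < m) L j).
    rewrite bigcup_mkord big_ord_recr/= -bigcup_mkord.
    by rewrite setUDr setDv setD0.
  by rewrite c_add ?setDIK// lerD2l c_mono.
rewrite (@le_trans _ _ (c (\bigcup_(j < n) L j))%:E) ?lee_fin ?c_mono//.
rewrite (le_trans (cL n))// (le_trans _ (nneseries_lim_ge n _))//; last first.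
  by move=> *; exact: open_content_ge0.
apply: lee_sum => j _; apply: content_le_open; first exact: closed_inner.
by apply: inner_sub; rewrite invr_gt0.
Qed.

Lemma content_outer_open U : open U -> content_outer U = open_content U.
Proof.
move=> oU; apply/eqP; rewrite eq_le; apply/andP; split.
  by apply: ereal_inf_lbound; exists U => //; split.
by apply: le_ereal_inf_tmp => _ [V [oV UV] <-]; exact: open_content_mono.
Qed.

Lemma content_outer_ge0 E : 0 <= content_outer E.
Proof.
by apply: le_ereal_inf_tmp => _ [V [oV UV] <-]; exact: open_content_ge0.
Qed.

Lemma content_outer0 : content_outer set0 = 0.
Proof.
rewrite content_outer_open; last exact: open0.
apply/eqP; rewrite eq_le open_content_ge0 andbT.
apply: ge_ereal_sup => _ [K [clK K0] <-]; move: K0.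
by rewrite subset0 => ->; rewrite content_set0.
Qed.

Lemma content_outer_mono : {homo content_outer : E F / E `<=` F >-> E <= F}.
Proof.
move=> E F EF; apply: le_ereal_inf_tmp => _ [V [oV FV] <-].
by apply: ereal_inf_lbound; exists V => //; split => //; exact: subset_trans FV.
Qed.

Lemma content_outer_fin E : content_outer E \is a fin_num.
Proof.
rewrite ge0_fin_numE ?content_outer_ge0//.
rewrite (le_lt_trans (content_outer_mono (@subsetT _ E)))//.
rewrite content_outer_open; last exact: openT.
by have := open_content_fin setT; rewrite ge0_fin_numE ?open_content_ge0.
Qed.

Lemma content_outer_sigma_subadditive : sigma_subadditive content_outer.
Proof.
move=> F; apply/lee_addgt0Pr => e e0.
have hU n : exists U, [/\ open U, F n `<=` U &
    open_content U <= content_outer (F n) + (e / (2 ^ n.+1)%:R)%:E].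
  have en0 : (0 < e / (2 ^ n.+1)%:R)%R by rewrite divr_gt0// ltr0n expn_gt0.
  have [_ [U [oU FU] <-] /ltW hU] := lb_ereal_inf_adherent en0 (content_outer_fin (F n)).
  by exists U.
have [U UP] := choice hU.
rewrite (le_trans _ (epsilon_trick _ _ (ltW e0)))//; last first.
  by move=> n; exact: content_outer_ge0.
have oU n : open (U n) by have [] := UP n.
rewrite (@le_trans _ _ (open_content (\bigcup_n U n)))//.
  apply: ereal_inf_lbound; exists (\bigcup_n U n) => //; split.
    exact: bigcup_open.
  by apply: subset_bigcup => n _; have [] := UP n.
rewrite (le_trans (open_content_bigcup oU))//; apply: lee_nneseries.
  by move=> n _ _; exact: open_content_ge0.
by move=> n _; have [] := UP n.
Qed.

(** Inside an open [V] containing the test set, exhaust [V `&` U] by a closed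
    [K] and then [V `\` K], which is open and contains [V `\` U], by a closed
    [L]: as [K] and [L] are disjoint, additivity of [c] applies. *)
Lemma content_outer_caratheodory U X0 : open U ->
  content_outer (X0 `&` U) + content_outer (X0 `&` ~` U) <= content_outer X0.
Proof.
move=> oU; apply: le_ereal_inf_tmp => _ [V [oV XV] <-].
have VU : content_outer (X0 `&` U) <= open_content (V `&` U).
  rewrite -content_outer_open; last exact: openI.
  by apply: content_outer_mono; exact: setSI.
rewrite (le_trans (leeD2r _ VU))// -leeBrDr ?content_outer_fin//.
apply: ge_ereal_sup => _ [K [clK KVU] <-].
rewrite leeBrDr ?content_outer_fin// addeC -leeBrDr//.
have oVK : open (V `\` K) by rewrite setDE; apply: openI => //; rewrite openC.
rewrite (@le_trans _ _ (open_content (V `\` K)))//.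
  apply: ereal_inf_lbound; exists (V `\` K) => //; split => // x [/XV Vx Ux].
  by split=> // /KVU[].
apply: ge_ereal_sup => _ [L [clL LVK] <-].
rewrite leeBrDr// -EFinD addrC -c_add.
  apply: content_le_open; first exact: closedU.
  by move=> x [/KVU[]//|/LVK[]].
by apply/seteqP; split=> // x [Kx /LVK[]].
Qed.

End OuterMeasureOfContent.

Section BorelProbabilityOfContent.
Variables (R : realType) (X : metricType R).
Local Open Scope ereal_scope.

(** For a general content the probability may differ from [c] on closed sets,
    as the content may charge all neighbourhoods of a closed set without
    charging the set; the inequality that survives has the direction needed to
    show that a set is charged. *)
Lemma borel_probability_of_content (c : set X -> R) (x0 : X) :
  compact [set: X] ->
  (forall K, 0 <= c K)%R ->
  (forall K L, K `<=` L -> c K <= c L)%R ->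
  (forall K L, K `&` L = set0 -> c (K `|` L) = c K + c L)%R ->
  c setT = 1%R ->
  exists P : probability (borel x0) R,
    [/\ forall U : set X, open U ->
          P U = ereal_sup [set (c K)%:E | K in [set K | closed K /\ K `<=` U]] &
        forall K : set X, closed K -> (c K)%:E <= P K].
Proof.
move=> cX c0 cm ca c1.
pose oA := isOuterMeasure.Build R X (content_outer c) (content_outer0 c0 ca)
  (content_outer_ge0 c0) (@content_outer_mono _ _ c)
  (content_outer_sigma_subadditive cX c0 cm ca).
pose mu : {outer_measure set X -> \bar R} := HB.pack (content_outer c) oA.
have [|/=|P PE] := @borel_probability_of_outer_measure R X mu x0.
- move=> U oU; apply: le_caratheodory_measurable => E.
  exact: content_outer_caratheodory.
- rewrite content_outer_open; last exact: openT.
  apply/eqP; rewrite eq_le; apply/andP; split; last first.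
    by rewrite -c1; apply: content_le_open => //; exact: closedT.
  by apply: ge_ereal_sup => _ [K _ <-]; rewrite -c1 lee_fin cm.
exists P; split => [U oU|K clK]; rewrite PE/=.
  by rewrite content_outer_open.
by apply: le_ereal_inf_tmp => _ [V [oV KV] <-]; exact: content_le_open.
Qed.

End BorelProbabilityOfContent.

(** * Empirical measures of pseudo-orbits and the measure center *)
Section Dynamics.
Variables (R : realType) (X : metricType R) (f : X -> X).
Hypotheses (cX : compact [set: X]) (cf : continuous f).
Local Open Scope ereal_scope.

Lemma borel_measurable_open (x0 : X) (U : set X) :
  open U -> measurable (U : set (borel x0)).
Proof. by move=> oU; exact: sub_sigma_algebra. Qed.

Lemma borel_measurable_closed (x0 : X) (K : set X) :
  closed K -> measurable (K : set (borel x0)).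
Proof.
move=> clK; rewrite -(setCK K); apply: (@measurableC _ (borel x0)).
by apply: borel_measurable_open; rewrite openC.
Qed.

Lemma continuous_borel_measurable (x0 : X) :
  measurable_fun setT (f : borel x0 -> borel x0).
Proof.
apply: (@measurability _ _ _ _ setT (f : borel x0 -> borel x0) (@open X)) => //.
move=> _ [U oU <-]; rewrite setTI; apply: borel_measurable_open.
by move/continuousP : cf; exact.
Qed.

Lemma invariant_measure_open (x0 : X) (P : probability (borel x0) R) :
  (forall U : set X, open U -> P U = P (f @^-1` U)) -> invariant_measure f P.
Proof.
move=> PU B mB.
pose Q : {measure set (borel x0) -> \bar R} :=
  measure_function_pushforward__canonical__measure_function_Measure P
    (@continuous_borel_measurable x0).
rewrite -[RHS]/(Q B).
apply: (@measure_unique _ R (borel x0) (@open X) (fun=> setT) _ _ _ _ P Q) => //.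
- by move=> U V; exact: openI.
- by move=> _; exact: openT.
- by apply/seteqP; split=> // x _; exists 0%N.
- by move=> _; apply: (le_lt_trans (probability_le1 P _)); rewrite ?ltry.
Qed.

(** A point all of whose neighbourhoods are charged by [P] forms a measure
    saturated singleton.  Hence every point of [K] has a null neighbourhood,
    and by compactness so has [K]. *)
Lemma measure_center_full (x0 : X) (P : probability (borel x0) R) (K : set X) :
  invariant_measure f P -> closed K -> K `&` measure_center f = set0 ->
  P K = 0.
Proof.
move=> iP clK KC.
have cK : compact K := subclosed_compact clK cX (@subsetT _ K).
have null_nbhd x : K x -> exists U : set X, [/\ open U, U x & P U = 0].
  move=> Kx; apply: contrapT => nU.
  suff : (K `&` measure_center f) x by rewrite KC.
  split=> //; exists [set x] => // V oV [y [Vy yx]]; rewrite yx in Vy.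
  exists x0, P; split => //; rewrite lt0e measure_ge0 andbT; apply/negP => /eqP PV.
  by apply: nU; exists V.
(* A filter on subsets of X generated by the null open sets: covering
   compactness along it extracts one null open set containing K. *)
pose N0 := [set N : set X | open N /\ P N = 0].
pose F := filter_from N0 (fun N => [set M : set X | N `<=` M]).
have FF : Filter F.
  apply: filter_from_filter; first by exists set0; split; [exact: open0|exact: measure0].
  move=> U V [oU U0] [oV V0]; exists (U `|` V).
    split; first exact: openU.
    by rewrite measureU0//; exact: borel_measurable_open.
  by move=> M UVM; split; apply: subset_trans UVM => x; [left|right].
move/compact_near_coveringP : cK => /(_ _ F (fun M x => M x) FF)[|N [oN N0'] KN].
  move=> x /null_nbhd[U [oU Ux U0]].
  exists (U, [set M : set X | U `<=` M]) => /=.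
    by split; [exact: open_nbhs_nbhs|exists U].
  by move=> [y M] [/= Uy UM]; exact: UM.
apply: (@subset_measure0 _ _ _ P _ (N : set (borel x0))) => //.
- exact: borel_measurable_closed.
- exact: borel_measurable_open.
- exact: KN.
Qed.

(** If [x] visited [K] with positive upper frequency, the content
    [L |-> density of the times at which x is in L] would yield a probability
    charging [K].  It is invariant: outside a set of times of density zero
    [x i.+1] is close to [f (x i)], so that visits of [x] to a closed subset of
    [f @^-1` U] are followed by visits to a slightly larger closed subset
    of [U], and conversely. *)
Lemma asymptotic_pseudo_orbit_null (x : nat -> X) (K : set X) :
  (forall delta : R, (0 < delta)%R -> ergodic_pseudo_orbit f delta x) ->
  closed K -> K `&` measure_center f = set0 -> null_density R [set i | K (x i)].
Proof.
move=> ox clK KC; apply: contrapT => nK.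
have [m [[mK mT m0] madd mshift msub]] := exists_generalized_density nK.
have null0 : null_density R set0.
  apply/null_densityP => e e0; exists 0%N => n; rewrite addr0 (_ : hits _ _ = 0%N).
    by rewrite mulr_ge0// ltW.
  by rewrite /hits big1// => i _; rewrite in_set0.
pose c (L : set X) := m [set i | L (x i)].
have cmono L M : L `<=` M -> (c L <= c M)%R.
  by move=> LM; apply: (msub _ _ set0) => //= i Li; left; exact: LM.
have [||||P [Popen Pclosed]] := @borel_probability_of_content R X c (x 0%N) cX.
- by move=> L; exact: m0.
- exact: cmono.
- move=> L M LM; rewrite -madd//; apply/seteqP; split=> // i [Li Mi].
  by suff : (L `&` M) (x i) by rewrite LM.
- exact: mT.
have iP : invariant_measure f P.
  apply: invariant_measure_open => U oU.
  have ofU : open (f @^-1` U) by move/continuousP : cf; exact.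
  have cpt (L : set X) : closed L -> compact L.
    by move=> clL; exact: (subclosed_compact clL cX).
  apply/eqP; rewrite eq_le; apply/andP; split.
    rewrite [leLHS]Popen//; apply: ge_ereal_sup => _ [L [clL LU] <-].
    have [r r0 Lr] := compact_inner (cpt _ clL) oU LU.
    have r20 : (0 < r / 2)%R by rewrite divr_gt0.
    pose M := f @^-1` inner U (r / 2).
    have clM : closed M.
      by move/continuous_closedP : cf; apply; exact: closed_inner.
    rewrite (@le_trans _ _ (c M)%:E)//; last first.
      rewrite (le_trans (Pclosed _ clM))// le_measure ?inE//.
      + exact: borel_measurable_closed.
      + exact: borel_measurable_open.
      + by move=> y; exact: inner_sub.
    rewrite lee_fin /c -[leLHS]mshift; apply: msub (ox _ r20) _ => i /= Lxi.
    have [hd|hd] := leP (r / 2)%R (mdist (f (x i)) (x i.+1)); [by right|left].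
    move=> y fy; apply: (Lr _ Lxi).
    rewrite (le_lt_trans (metric_triangle _ (f (x i)) _))// [ltRHS]splitr.
    by rewrite ltrD// metric_sym.
  rewrite [leLHS]Popen//; apply: ge_ereal_sup => _ [L [clL LU] <-].
  have cfL : compact (f @` L).
    by apply: continuous_compact (cpt _ clL); exact: continuous_subspaceT.
  have [|r r0 Lr] := compact_inner cfL oU; first by move=> _ [y /LU ? <-].
  have r20 : (0 < r / 2)%R by rewrite divr_gt0.
  pose M := inner U (r / 2).
  have clM : closed M by exact: closed_inner.
  rewrite (@le_trans _ _ (c M)%:E)//; last first.
    rewrite (le_trans (Pclosed _ clM))// le_measure ?inE//.
    + exact: borel_measurable_closed.
    + exact: borel_measurable_open.
    + exact: inner_sub.
  rewrite lee_fin /c -[leRHS]mshift; apply: msub (ox _ r20) _ => i /= Lxi.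
  have [hd|hd] := leP (r / 2)%R (mdist (f (x i)) (x i.+1)); [by right|left].
  move=> y xy; apply: (Lr (f (x i))); first by exists (x i).
  rewrite (le_lt_trans (metric_triangle _ (x i.+1) _))// [ltRHS]splitr.
  by rewrite ltrD.
have := Pclosed K clK; rewrite (measure_center_full iP clK KC) lee_fin.
by rewrite leNgt mK.
Qed.

End Dynamics.

(** * Gluing pseudo-orbits *)
Section Concatenation.

Lemma hits_set1 a n : (hits [set a] n <= 1)%N.
Proof.
suff -> : hits [set a] n = (a < n)%N by case: (a < n)%N.
elim: n => [|n IH]; first by rewrite hits0.
rewrite hitsS IH; have -> : (n \in [set a]) = (n == a).
  by apply/idP/idP => [/set_mem ->|/eqP ->]; rewrite ?inE.
by rewrite ltnS; case: ltngtP.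
Qed.

Lemma block_of (S : nat -> nat) : S 0%N = 0%N ->
  (forall k, (S k < S k.+1)%N) -> forall n, exists k, (S k <= n < S k.+1)%N.
Proof.
move=> S0 Sinc; elim=> [|n [k /andP[Skn nSk]]].
  by exists 0%N; rewrite S0 (leq_trans _ (Sinc 0%N)).
have [nk|] := ltnP n.+1 (S k.+1); first by exists k; rewrite nk (leq_trans Skn).
by move=> nk; exists k.+1; rewrite nk (leq_ltn_trans nSk).
Qed.

Lemma concatenation (T : Type) (x : nat -> nat -> T) (S : nat -> nat) :
  S 0%N = 0%N -> (forall k, (S k < S k.+1)%N) ->
  exists y : nat -> T, forall k m, (S k + m < S k.+1)%N -> y (S k + m)%N = x k m.
Proof.
move=> S0 Sinc; have [b bP] := choice (block_of S0 Sinc).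
have Smono : {mono S : j k / (j <= k)%N}.
  by apply: leq_mono; apply: homo_ltn Sinc; exact: ltn_trans.
exists (fun n => x (b n) (n - S (b n))%N) => k m km.
suff -> : b (S k + m)%N = k by rewrite addKn.
have /andP[b1 b2] := bP (S k + m)%N.
apply/eqP; rewrite eqn_leq -[(b _ <= k)%N]ltnS -[(k <= b _)%N]ltnS.
rewrite -[(b _ < _)%N](leqW_mono Smono) -[(k < _)%N](leqW_mono Smono).
rewrite (leq_ltn_trans b1 km)/=.
by rewrite (leq_ltn_trans _ b2)// leq_addr.
Qed.

Variables (R : realType) (X : metricType R) (f : X -> X).

(** [N k s] is a lower bound for the length of the [k]-th segment, which may
    depend on the time [s] at which this segment starts. *)
Lemma concatenated_pseudo_orbit (x : nat -> nat -> X) (N : nat -> nat -> nat) :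
  (forall k, ergodic_pseudo_orbit f (k.+1%:R^-1 : R) (x k)) ->
  exists (S : nat -> nat) (y : nat -> X),
    (forall delta : R, 0 < delta -> ergodic_pseudo_orbit f delta y) /\
    forall k m, (m < N k (S k))%N -> y (S k + m)%N = x k m.
Proof.
move=> ox.
pose err k := [set i | k.+1%:R^-1 <= mdist (f (x k i)) (x k i.+1)].
have hB k : exists B : nat, forall n,
    (hits (err k) n)%:R <= k.+1%:R^-1 * n%:R + B%:R :> R.
  have /null_densityP := ox k; apply; by rewrite invr_gt0.
have [B BP] := choice hB.
(* The second term makes the constant B k.+1 of the next segment, together with
   the error at the junction, at most 1/(k+1) times the present length. *)
pose L k s := (N k s + k.+1 * (B k.+1).+1)%N.
pose S := fix S k := if k is j.+1 then (S j + L j (S j))%N else 0%N.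
have SS k : S k.+1 = (S k + L k (S k))%N by [].
have Sinc k : (S k < S k.+1)%N.
  by rewrite SS -[ltnLHS]addn0 ltn_add2l /L mulnS addnC -addnA.
have [y yP] := concatenation x (erefl : S 0%N = 0%N) Sinc.
exists S, y; split=> [delta delta0|k m mN]; last first.
  by apply: yP; rewrite SS ltn_add2l (leq_trans mN)// leq_addr.
pose E := [set i | delta <= mdist (f (y i)) (y i.+1)].
have step k m : k.+1%:R^-1 <= delta -> (S k + m <= S k.+1)%N ->
    (hits E (S k + m))%:R <=
    (hits E (S k))%:R + k.+1%:R^-1 * m%:R + (B k).+1%:R :> R.
  move=> kd km; rewrite hits_cat natrD -addrA lerD2l.
  rewrite (@le_trans _ _ (hits (err k) m + 1)%:R)//; last first.
    by rewrite natrD -[(B k).+1%:R]natr1 addrA lerD2r.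
  rewrite ler_nat (leq_trans _ (leq_add (leqnn _) (hits_set1 (L k (S k)).-1 m)))//.
  rewrite (leq_trans _ (hits_setU _ _ _))//.
  apply: hits_sub => i im; rewrite /E/= => Ei.
  have ik : (S k + i < S k.+1)%N by rewrite (leq_trans _ km)// ltn_add2l.
  have [ik'|ik'] := ltnP (S k + i.+1) (S k.+1); [left|right].
    by rewrite /err/= (le_trans kd)// -(yP _ _ ik) -(yP _ _ ik') addnS.
  by move: ik ik'; rewrite SS ltn_add2l leq_add2l /=; lia.
apply/null_densityP => e e0.
have e20 : 0 < e / 2 by rewrite divr_gt0.
have [k1 k1d k1e] : exists2 k1, k1.+1%:R^-1 <= delta & k1.+1%:R^-1 <= e / 2.
  have [k1 _ hk] := filterI (near_invS delta0) (near_invS e20).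
  by have [/ltW ? /ltW ?] := hk k1 (leqnn _); exists k1.
have kle k : (k1 <= k)%N -> k.+1%:R^-1 <= k1.+1%:R^-1 :> R.
  by move=> kk; rewrite lef_pV2 ?posrE// ler_nat.
exists (hits E (S k1) + (B k1).+1)%N.
set C := (_ + _)%N.
(* Adding (B k).+1 on the left makes the estimate inductive: it charges to
   segment k the early errors of segment k.+1. *)
have main k : (k1 <= k)%N ->
    (hits E (S k))%:R + (B k).+1%:R <= e * (S k)%:R + C%:R.
  move=> /subnKC <-; elim: (k - k1)%N => [|j IH].
    by rewrite addn0 -natrD lerDr mulr_ge0// ltW.
  rewrite addnS; move: IH; set k' := (k1 + j)%N => IH.
  have k1k : (k1 <= k')%N by rewrite leq_addr.
  have kd := le_trans (kle _ k1k) k1d; have ke := le_trans (kle _ k1k) k1e.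
  have := step k' (L k' (S k')) kd (leqnn _); rewrite -SS => hstep.
  have hBL : (B k'.+1).+1%:R <= k'.+1%:R^-1 * (L k' (S k'))%:R :> R.
    by rewrite ler_pdivlMl// -natrM ler_nat leq_addl.
  have hL : k'.+1%:R^-1 * (L k' (S k'))%:R <= e / 2 * (L k' (S k'))%:R :> R.
    by rewrite ler_wpM2r.
  rewrite [in leRHS]SS natrD mulrDr.
  move: hstep hBL hL IH; set q := k'.+1%:R^-1 * _; set l := (L k' (S k'))%:R.
  have -> : e / 2 * l = (e * l) / 2 by ring.
  set el := e * l; set es := e * _ => ? ? ? ?; lra.
move=> n.
have [nS|Sn] := ltnP n (S k1).
  rewrite (@le_trans _ _ C%:R)//; last by rewrite lerDr mulr_ge0// ltW.
  by rewrite ler_nat (leq_trans (hits_mono _ (ltnW nS)))// leq_addr.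
have [k /andP[Skn nSk]] := block_of (erefl : S 0%N = 0%N) Sinc n.
have Smono : {mono S : j k / (j <= k)%N}.
  by apply: leq_mono; apply: homo_ltn Sinc; exact: ltn_trans.
have k1k : (k1 <= k)%N.
  by rewrite -ltnS -(leqW_mono Smono) (leq_ltn_trans Sn).
have kd := le_trans (kle _ k1k) k1d; have ke := le_trans (kle _ k1k) k1e.
have := step k (n - S k)%N kd; rewrite subnKC// => /(_ (ltnW nSk)) hstep.
have hm := main k k1k.
have hL : k.+1%:R^-1 * (n - S k)%:R <= e / 2 * (n - S k)%:R :> R.
  by rewrite ler_wpM2r.
have hn : n%:R = (S k)%:R + (n - S k)%:R :> R by rewrite -natrD subnKC.
have h0 : 0 <= e / 2 * (n - S k)%:R by rewrite mulr_ge0// ltW.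
rewrite hn mulrDr.
move: hstep hm hL h0; set q := k.+1%:R^-1 * _; set l := (n - S k)%:R.
have -> : e / 2 * l = (e * l) / 2 by ring.
set el := e * l; set es := e * _ => ? ? ? ?; lra.
Qed.

End Concatenation.

(** * Shadowing *)
Section ShadowingOfPseudoOrbits.
Variables (R : realType) (X : metricType R) (f : X -> X).
Hypotheses (cX : compact [set: X]) (cf : continuous f).

Lemma continuous_metric (g : X -> X) (x : X) (e : R) :
  continuous g -> 0 < e -> \forall y \near x, mdist (g x) (g y) < e.
Proof. by move=> cg e0; exact: (cg x _ (near_metric (g x) e0)). Qed.

Lemma uniformly_continuous_metric (e : R) : 0 < e ->
  exists2 eta : R, 0 < eta &
    forall x y, mdist x y < eta -> mdist (f x) (f y) < e.
Proof.
move=> e0; have e20 : 0 < e / 2 by rewrite divr_gt0.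
move/compact_near_coveringP : cX => /(_ nat \oo
  (fun n x => forall y, mdist x y < n.+1%:R^-1 -> mdist (f x) (f y) < e) _).
case=> [x _|n _ hn]; last first.
  exists n.+1%:R^-1; rewrite ?invr_gt0// => x y.
  by apply: (hn n (leqnn n)).
have /nbhs_ballP[r /= r0 hr] := continuous_metric x cf e20.
have r20 : 0 < r / 2 by rewrite divr_gt0.
near=> x' n => /= y x'y.
have xx' : mdist x x' < r / 2 by near: x'; exact: near_metric.
have nr : n.+1%:R^-1 < r / 2 by near: n; exact: near_invS.
have h1 : mdist (f x) (f x') < e / 2.
  by apply: hr; rewrite ballEmdist/= (lt_trans xx')// gtr_pMr// invf_lt1// ltr1n.
have h2 : mdist (f x) (f y) < e / 2.
  apply: hr; rewrite ballEmdist/= (le_lt_trans (metric_triangle _ x' _))//.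
  by rewrite [ltRHS]splitr ltrD// (lt_trans x'y).
rewrite (le_lt_trans (metric_triangle _ (f x) _))// [ltRHS]splitr ltrD//.
by rewrite metric_sym.
Unshelve. all: by end_near. Qed.

(** Passing from the strict [eps] to the closed condition with [eps' < eps]
    makes the failure at a given time an open condition on [z], so that
    compactness bounds the time of failure. *)
Lemma unshadowable_segment (x : nat -> X) (alpha c eps eps' : R) (s : nat) :
  (forall z, ~ (alpha%:E <
     lower_density R [set i | (mdist (iter i f z) (x i) < eps)%R])%E) ->
  alpha < c -> eps' < eps ->
  exists N : nat, forall z, exists2 n, (n <= N)%N &
    (hits [set i | mdist (iter i f z) (x i) <= eps'] n)%:R + s%:R < c * n%:R.
Proof.
move=> hx ac ee.
move/compact_near_coveringP : cX => /(_ nat \oo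
  (fun N z => exists2 n, (n <= N)%N &
    (hits [set i | mdist (iter i f z) (x i) <= eps'] n)%:R + s%:R < c * n%:R) _).
case=> [z _|N _ hN]; last by exists N => z; exact: (hN N (leqnn N)).
have [n hn] : exists n : nat,
    (hits [set i | mdist (iter i f z) (x i) < eps] n)%:R + s%:R < c * n%:R.
  apply: contrapT => /forallNP h; apply: (hx z).
  apply/lower_densityP; exists c => //; exists s => n.
  by rewrite leNgt; apply/negP; exact: h.
have citer i : continuous (iter i f).
  elim: i => [|i IH] w; first exact: cvg_id.
  by apply: (@continuous_comp _ _ _ (iter i f) f); [exact: IH|exact: cf].
have ed : 0 < eps - eps' by rewrite subr_gt0.
have close : \forall z' \near z, forall i : 'I_n,
    mdist (iter i f z) (iter i f z') < eps - eps'.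
  by apply: filter_forall => i; exact: continuous_metric.
near=> z' N => /=; exists n; first by near: N; exists n.
apply: le_lt_trans hn; rewrite lerD2r ler_nat; apply: hits_sub => i im /= zi.
rewrite (le_lt_trans (metric_triangle _ (iter i f z') _))//.
rewrite -[ltRHS](subrK eps') ltr_leD//.
by move: {zi} i im; near: z'; apply: filterS close => z' h i im; exact: (h (Ordinal im)).
Unshelve. all: by end_near. Qed.

Lemma restrict_sys_iter (A : set X) (fA : set_fun A A f) (z : A) i :
  set_val (iter i (restrict_sys fA) z) = iter i f (set_val z).
Proof. by elim: i => // i IH; rewrite [RHS]iterS -IH. Qed.

(** The approximation [a] of [y] by points of [A] makes large jumps, or is far
    from [y], only on a set of times of density zero.  Hence [a] can be shadowed
    inside [A], and passing from [a] back to [y] costs no density. *)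
Lemma shadow_asymptotic_pseudo_orbit (A : set X) (fA : set_fun A A f)
    (alpha eps : R) (y : nat -> X) :
  measure_center f `<=` A -> M_shadowing (restrict_sys fA) alpha -> 0 < eps ->
  (forall delta : R, 0 < delta -> ergodic_pseudo_orbit f delta y) ->
  exists z : X,
    (alpha%:E < lower_density R [set i | (mdist (iter i f z) (y i) < eps)%R])%E.
Proof.
move=> CA shA eps0 oy.
have eps20 : 0 < eps / 2 by rewrite divr_gt0.
have [delta delta0 hdelta] := shA _ eps20.
have d30 : 0 < delta / 3 by rewrite divr_gt0.
have [eta eta0 heta] := uniformly_continuous_metric d30.
pose r := Num.min eta (Num.min (eps / 2) (delta / 3)).
have r0 : 0 < r by rewrite !lt_min eta0 eps20.
pose U := [set x : X | exists a : A, mdist x (set_val a) < r].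
have clU : closed (~` U).
  rewrite closedC; apply/metric_openP => x [a xa].
  exists (r - mdist x (set_val a)); first by rewrite subr_gt0.
  move=> x' xx'; exists a; rewrite (le_lt_trans (metric_triangle _ x _))//.
  by rewrite -ltrBrDr metric_sym.
have nU : null_density R [set i | ~ U (y i)].
  apply: (asymptotic_pseudo_orbit_null cX cf oy clU).
  apply/seteqP; split=> // x [Ux /CA Ax]; apply: Ux.
  by exists (SigSub (mem_set Ax)); rewrite mdistxx.
have [a0 _] : exists a0 : A, True.
  apply: contrapT => nA; move/null_densityP : nU => /(_ 2^-1)[|B hB].
    by rewrite invr_gt0.
  have := hB (B + B).+1; rewrite (_ : [set i | _] = setT).
    rewrite hitsT -natr1 natrD; have : 0 <= B%:R :> R by []; lra.
  by apply/seteqP; split=> // i _ [a _]; apply: nA; exists a.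
have ha i : exists a : A, U (y i) -> mdist (y i) (set_val a) < r.
  by have [[a ya]|nUi] := pselect (U (y i)); [exists a|exists a0].
have [a aP] := choice ha.
have oa : ergodic_pseudo_orbit (restrict_sys fA) delta a.
  have nUU := null_density_setU nU (null_density_shift nU).
  apply: (null_density_sub _ (null_density_setU nUU (oy _ d30))).
  move=> i /= di; apply: contrapT => /not_orP[/not_orP[/contrapT Ui /contrapT Ui']].
  move=> /negP; rewrite -ltNge => fyi; move: di; apply/negP; rewrite -ltNge.
  have := aP _ Ui; rewrite !lt_min => /andP[h1 _].
  have := aP _ Ui'; rewrite !lt_min => /and3P[_ _ h2].
  have h3 := heta _ _ h1.
  have t1 := metric_triangle (f (set_val (a i))) (f (y i)) (set_val (a i.+1)).
  have t2 := metric_triangle (f (y i)) (y i.+1) (set_val (a i.+1)).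
  rewrite metric_sym in h3.
  rewrite -[ltLHS]/(mdist (f (set_val (a i))) (set_val (a i.+1))).
  lra.
have [z /lower_densityP[c ac [B hB]]] := hdelta _ oa.
exists (set_val z); apply/lower_densityP.
exists ((c + alpha) / 2); first by lra.
have ca0 : 0 < (c - alpha) / 2 by rewrite divr_gt0// subr_gt0.
move/null_densityP : nU => /(_ _ ca0)[B' hB']; exists (B + B')%N => n.
have := hB n; have := hB' n.
have : (hits [set i | (mdist (iter i (restrict_sys fA) z) (a i) < eps / 2)%R] n <=
    hits [set i | (mdist (iter i f (set_val z)) (y i) < eps)%R] n +
    hits [set i | ~ U (y i)] n)%N.
  rewrite (leq_trans _ (hits_setU _ _ _))//; apply: hits_sub => i _ /= zi.
  have [Ui|] := pselect (U (y i)); [left|by right].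
  have := aP _ Ui; rewrite !lt_min => /and3P[_ h1 _].
  rewrite metric_sym in h1.
  have zi' : mdist (iter i f (set_val z)) (set_val (a i)) < eps / 2.
    by rewrite -(restrict_sys_iter fA).
  by rewrite (le_lt_trans (metric_triangle _ (set_val (a i)) _))// [ltRHS]splitr ltrD.
rewrite -(ler_nat R) !natrD => h1 h2 h3.
have -> : (c + alpha) / 2 * n%:R = c * n%:R - (c - alpha) / 2 * n%:R by field.
lra.
Qed.

End ShadowingOfPseudoOrbits.

Theorem theorem6p2 (R : realType) (X : metricType R) (f : X -> X)
    (A : set X) (fA : set_fun A A f) (alpha : R) :
  compact [set: X] -> continuous f ->
  closed A -> measure_center f `<=` A ->
  0 <= alpha < 1 ->
  M_shadowing (restrict_sys fA) alpha ->
  M_shadowing f alpha.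
Proof.
move=> cX cf _ CA /andP[alpha0 _] shA.
apply: contrapT => /existsNP[eps /not_implyP[eps0 /forall2NP nsh]].
have hx k : exists x : nat -> X, ergodic_pseudo_orbit f (k.+1%:R^-1 : R) x /\
    forall z, ~ (alpha%:E <
      lower_density R [set i | (mdist (iter i f z) (x i) < eps)%R])%E.
  have [/negP|/existsNP[x /not_implyP[ox nz]]] := nsh k.+1%:R^-1.
    by rewrite invr_gt0 ltr0n.
  by exists x; split=> // z az; apply: nz; exists z.
have [x xP] := choice hx.
have eps20 : 0 < eps / 2 by rewrite divr_gt0.
have eps2 : eps / 2 < eps by rewrite gtr_pMr// invf_lt1// ltr1n.
pose long k s N := forall z, exists2 n, (n <= N)%N &
  (hits [set i | mdist (iter i f z) (x k i) <= eps / 2] n)%:R + (s + k)%:R <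
  (alpha + k.+1%:R^-1) * n%:R.
have hlong k s : exists N, long k s N.
  apply: (unshadowable_segment cX cf _ _ _ eps2); first exact: (xP k).2.
  by rewrite ltrDl invr_gt0.
have hN k : exists N : nat -> nat, forall s, long k s (N s).
  by have [N NP] := choice (hlong k); exists N.
have [N NP] := choice hN.
have [S [y [oy yx]]] := concatenated_pseudo_orbit N (fun k => (xP k).1).
have [z] := shadow_asymptotic_pseudo_orbit cX cf CA shA eps20 oy.
move=> /lower_densityP[c ac [B hB]].
have ca0 : 0 < c - alpha by rewrite subr_gt0.
(* The k-th segment starts at S k; the S k hits conceded cover the past, and
   the further k ones cover the constant B. *)
have [k kB kc] : exists2 k, (B <= k)%N & k.+1%:R^-1 < c - alpha.
  have [k0 _ hk] := near_invS ca0.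
  by exists (maxn B k0); [exact: leq_maxl|apply: hk; exact: leq_maxr].
have [n nN hn] := NP k (S k) (iter (S k) f z).
have := hB (S k + n)%N; rewrite hits_cat.
have : (hits [set i | (mdist (iter (S k + i) f z) (y (S k + i)%N) < eps / 2)%R] n <=
    hits [set i | (mdist (iter i f (iter (S k) f z)) (x k i) <= eps / 2)%R] n)%N.
  apply: hits_sub => i im /=.
  by rewrite addnC iterD addnC yx ?(leq_trans im)// => /ltW.
have := hits_le [set i | mdist (iter i f z) (y i) < eps / 2] (S k).
rewrite -!(ler_nat R) !natrD in kB hn * => h1 h2.
apply/negP; rewrite -ltNge.
have c0 : 0 <= c by rewrite (le_trans alpha0)// ltW.
have h3 : 0 <= (c - (alpha + k.+1%:R^-1)) * n%:R.
  by rewrite mulr_ge0// subr_ge0 -lerBrDl ltW.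
have h4 : 0 <= c * (S k)%:R by rewrite mulr_ge0.
move: h3 hn; rewrite mulrBl mulrDr; set p := (_ + _^-1) * _ => h3 hn.
lra.
Qed.
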